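(* Let $n\ge 4$, let $U$ be an $n\times n$ complex unitary matrix such that $H=\sqrt{n}\,U=(h_{ij})$ is a complex Hadamard matrix. Then $$\delta_2(U)=\frac{n-3}{2n}+\frac{1}{n^4}\sum_{1\le p<q\le n}\left|\sum_{j=1}^n h_{pj}^2\,\overline{h_{qj}^2}\right|^2=\frac{n-3}{2n}+\frac{1}{2n^4}\left\|H^{\circ 2}(H^{\circ 2})^*-nI_n\right\|_F^2.$$ Consequently, $\delta_2(U)\ge\frac{n-3}{2n}$, with equality if and only if $H^{\circ 2}=(\sqrt{n}\,U)^{\circ 2}$ is a complex Hadamard matrix.
   Context: Notation: $[n]=\{1,\dots,n\}$, and $U[I,J]$ is the submatrix of $U$ with row set $I$ and column set $J$. A complex Hadamard matrix of order $n$ is an $n\times n$ complex matrix $H=(h_{ij})$ with $|h_{ij}|=1$ for all $i,j$ and $HH^*=nI_n$. $H^{\circ 2}=(h_{ij}^2)$ is the entrywise square, and $\|A\|_F=(\sum_{i,j}|a_{ij}|^2)^{1/2}$ is the Frobenius norm. For an $n\times n$ unitary matrix $U$, the second uniform-minor discrepancy is $$\delta_2(U)=\sum_{\substack{I,J\subset[n]\\|I|=|J|=2}}\left(|\det U[I,J]|^2-\binom{n}{2}^{-1}\right)^2.$$ *)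

(* Defs.v *)
From mathcomp Require Import all_boot all_order all_algebra.

Set Implicit Arguments.
Unset Strict Implicit.
Unset Printing Implicit Defensive.

Import Order.TTheory GRing.Theory Num.Theory.
Local Open Scope ring_scope.
Local Open Scope sesquilinear_scope.

(* Moduli, norms and discrepancies take values in C, as `|z| does in MathComp;
   x <= y in C entails that y - x is real. *)

Section Defs.
Variable C : numClosedFieldType.

(* U[I, J]: enum_val lists the elements of a subset of 'I_n in increasing
   order. *)
Definition submatrix m n (U : 'M[C]_(m, n)) (I : {set 'I_m}) (J : {set 'I_n}) :
    'M[C]_(#|I|, #|J|) :=
  mxsub (@enum_val _ (mem I)) (@enum_val _ (mem J)) U.

(* conform_mx only transports the #|I| x #|J| submatrix to type 'M_2; the
   default value 0 is never used in delta2, where #|I| = #|J| = 2. *)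
Definition minor2 m n (U : 'M[C]_(m, n)) (I : {set 'I_m}) (J : {set 'I_n}) : C :=
  \det (conform_mx (0 : 'M[C]_2) (submatrix U I J)).

Definition delta2 n (U : 'M[C]_n) : C :=
  \sum_(I : {set 'I_n} | #|I| == 2%N) \sum_(J : {set 'I_n} | #|J| == 2%N)
    (`|minor2 U I J| ^+ 2 - ('C(n, 2)%:R)^-1) ^+ 2.

Definition complex_hadamard n (H : 'M[C]_n) : Prop :=
  (forall i j, `|H i j| = 1) /\ H *m H ^t* = n%:R *: 1%:M.

Definition hadamard_square m n (A : 'M[C]_(m, n)) : 'M[C]_(m, n) :=
  map_mx (fun x => x ^+ 2) A.

Definition frobenius_norm m n (A : 'M[C]_(m, n)) : C :=
  sqrtC (\sum_i \sum_j `|A i j| ^+ 2).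

End Defs.

(* Main.v *)
Require Import Defs.
From mathcomp Require Import all_boot all_order all_algebra.
From mathcomp Require Import complex.
From mathcomp Require Import reals.
From mathcomp Require Import ring zify.

Set Implicit Arguments.
Unset Strict Implicit.
Unset Printing Implicit Defensive.

Import Order.TTheory GRing.Theory Num.Theory.
Local Open Scope ring_scope.
Local Open Scope sesquilinear_scope.

(** Fix rows p < q of H and put z_j = h_pj (h_qj)^*. All entries of H have
    modulus 1, so n^2 |det U[{p,q}, {i,j}]|^2 = 2 - z_i z_j^* - z_j z_i^*: one
    pair of rows enters the discrepancy only through the unimodular vector z
    ([norm_det2_unimodular]). As z_i z_j^* has inverse z_j z_i^*, the squared
    deviation of the squared minor from a number c is a constant plus a multiple
    of z_i z_j^* + z_j z_i^* plus a multiple of z_i^2 (z_j^2)^* + z_j^2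
    (z_i^2)^* ([unimodular_sqr_deviation]).

    The summand is symmetric in i and j, so summing over i < j amounts to
    summing over all ordered pairs and discarding the diagonal. Over ordered
    pairs the two oscillating terms become multiples of |sum_j z_j|^2, which
    vanishes because the rows are orthogonal, and of S_pq = |sum_j z_j^2|^2, the
    contribution of the rows to the Gram matrix of the entrywise square
    ([sum_sqr_deviation]). With c = 2 / (n (n - 1)) each pair of rows thus
    yields 3 / n^2 - 2 / (n (n - 1)) + S_pq / n^4, and the constants add up
    over the n (n - 1) / 2 pairs to (n - 3) / (2 n) ([delta2_hadamard]).

    The S_pq are the squared moduli of the off-diagonal entries of the Gram
    matrix, whose diagonal is n; each occurs twice, at (p, q) and at (q, p), so
    their sum over p < q is half of the squared Frobenius norm of the Gram
    matrix minus n times the identity. This norm vanishes exactly when the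
    entrywise square, which is unimodular in any case, is Hadamard. *)

(** * Sums over two-element subsets *)

Lemma sum_card2_sets (V : nmodType) n (F : {set 'I_n} -> V) :
  \sum_(I : {set 'I_n} | #|I| == 2%N) F I =
  \sum_(p < n) \sum_(q < n | (p < q)%N) F [set p; q].
Proof.
rewrite pair_big_dep /=.
pose f (x : 'I_n * 'I_n) := [set x.1; x.2].
pose D := [set x : 'I_n * 'I_n | (x.1 < x.2)%N].
have injf : {in D &, injective f}.
  move=> [p q] [r s]; rewrite !inE /f /= => pq rs E.
  have : p \in [set r; s] by rewrite -E set21.
  have : q \in [set r; s] by rewrite -E set22.
  have : r \in [set p; q] by rewrite E set21.
  rewrite !inE -!val_eqE /=.
  move=> h1 h2 h3; congr pair; apply/val_inj => /=; lia.
have imf : [set I : {set 'I_n} | #|I| == 2%N] = f @: D.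
  apply/setP=> I; rewrite inE; apply/cards2P/imsetP.
    move=> [x [y [neq_xy ->]]]; case: (ltngtP x y) => cmp.
    - by exists (x, y); rewrite ?inE.
    - by exists (y, x); rewrite ?inE // /f setUC.
    - by case/eqP: neq_xy; apply/val_inj.
  move=> [[x y]]; rewrite inE /= => lt_xy ->.
  by exists x, y; split=> //; rewrite neq_ltn lt_xy.
rewrite (eq_bigl (mem (f @: D))) => [|I]; last by rewrite /= -imf inE.
rewrite big_imset //=.
by apply: eq_bigl => x; rewrite inE.
Qed.

(** Trades an ordered range of pairs, on which sums do not factor, for the full
    square, on which they do. *)
Lemma sum_ltn_symmetric (V : zmodType) n (f : 'I_n -> 'I_n -> V) :
  (forall p q, f p q = f q p) ->
  (\sum_(p < n) \sum_(q < n | (p < q)%N) f p q) *+ 2 =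
  \sum_(p < n) \sum_(q < n) f p q - \sum_(p < n) f p p.
Proof.
move=> f_sym; apply/eqP; rewrite eq_sym subr_eq mulr2n; apply/eqP.
have {2}-> : \sum_(p < n) \sum_(q < n | (p < q)%N) f p q =
    \sum_(p < n) \sum_(q < n | (q < p)%N) f p q.
  rewrite (exchange_big_dep predT) //=.
  by apply: eq_bigr => p _; apply: eq_bigr => q _.
rewrite -!big_split /=; apply: eq_bigr => p _.
rewrite (bigID (fun q : 'I_n => (p < q)%N)) /= -addrA; congr (_ + _).
rewrite (bigD1 p) /= ?ltnn // addrC; congr (_ + _).
by apply: eq_bigl => q; rewrite -leqNgt ltn_neqAle andbC.
Qed.

Lemma enum_set2 (T : finType) (p q : T) :
  p != q -> enum [set p; q] = [:: p; q] \/ enum [set p; q] = [:: q; p].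
Proof.
move=> neq_pq.
have Epq : perm_eq (enum [set p; q]) [:: p; q].
  apply: uniq_perm; rewrite ?enum_uniq //= ?inE ?neq_pq //.
  by move=> x; rewrite mem_enum !inE.
have := perm_size Epq; move: Epq; case: (enum _) => [|x [|y [|z s]]] //= Epq _.
have := perm_mem Epq x; have := perm_mem Epq y; have := perm_uniq Epq.
rewrite /= !inE !eqxx ?orbT /= neq_pq andbT => neq_xy.
move=> /esym/orP[]/eqP Ey /esym/orP[]/eqP Ex; subst;
  rewrite ?eqxx // in neq_xy *.
- by right.
- by left.
Qed.

Lemma sumr_const_ord (R : pzSemiRingType) n (k : R) : \sum_(i < n) k = n%:R * k.
Proof. by rewrite sumr_const card_ord mulr_natl. Qed.

Lemma natr_bin2 (R : pzRingType) n :
  2 * 'C(n, 2)%:R = n%:R * (n%:R - 1) :> R.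
Proof.
rewrite bin2 -natrM mul2n halfK oddM.
case: n => [|n]; first by rewrite mul0r.
by rewrite /= andNb subn0 natrM; congr (_ * _); rewrite -natr1 addrK.
Qed.

Lemma card_ltn_pairs (F : numFieldType) n :
  \sum_(p < n) \sum_(q < n | (p < q)%N) 1 = n%:R * (n%:R - 1) / 2 :> F.
Proof.
have two0 : 2 != 0 :> F by rewrite pnatr_eq0.
apply: (mulIf two0); rewrite mulfVK // mulr_natr sum_ltn_symmetric //.
under eq_bigr do rewrite sumr_const_ord.
by rewrite !sumr_const_ord; ring.
Qed.

(** * Squared moduli of 2 x 2 minors *)

Section Minors.
Variable C : numClosedFieldType.

(** Indexing rows and columns by functions on [nat] frees the entries from the
    dimensions k and l, which can then be replaced by 2 without casts. *)
Lemma conform_mx_nat_fun k l m n (U : 'M[C]_(m, n)) (f : nat -> 'I_m)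
    (g : nat -> 'I_n) (B : 'M[C]_2) :
  k = 2%N -> l = 2%N ->
  conform_mx B (\matrix_(i < k, j < l) U (f i) (g j)) =
  \matrix_(i < 2, j < 2) U (f i) (g j).
Proof. by move=> -> ->; rewrite conform_mx_id. Qed.

Lemma minor2_nth m n (U : 'M[C]_(m, n)) (I : {set 'I_m}) (J : {set 'I_n}) p i :
  let r a := nth p (enum I) a in let c b := nth i (enum J) b in
  #|I| = 2%N -> #|J| = 2%N ->
  minor2 U I J =
  U (r 0%N) (c 0%N) * U (r 1%N) (c 1%N) - U (r 0%N) (c 1%N) * U (r 1%N) (c 0%N).
Proof.
move=> r c cardI cardJ.
have -> : minor2 U I J = \det (\matrix_(a < 2, b < 2) U (r a) (c b)).
  rewrite /minor2 -(conform_mx_nat_fun _ _ _ 0 cardI cardJ).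
  congr (\det (conform_mx _ _)).
  by apply/matrixP=> a b; rewrite !mxE (enum_val_nth p) (enum_val_nth i).
rewrite (expand_det_row _ ord0) !big_ord_recl big_ord0 /cofactor !det_mx11.
rewrite !mxE /=.
by rewrite /bump /= expr0 expr1 mul1r mulN1r mulrN addr0.
Qed.

(** Listing the rows or the columns in the other order only changes the sign of
    the minor, which the modulus forgets. *)
Lemma norm_minor2 m n (U : 'M[C]_(m, n)) p q i j :
  p != q -> i != j ->
  `|minor2 U [set p; q] [set i; j]| ^+ 2 =
  `|U p i * U q j - U p j * U q i| ^+ 2.
Proof.
move=> neq_pq neq_ij; rewrite (minor2_nth _ p i) ?cards2 ?neq_pq ?neq_ij //.
case: (enum_set2 neq_pq) => ->; case: (enum_set2 neq_ij) => -> //=.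
- by rewrite -normrN opprB.
- by rewrite -normrN opprB ![U q _ * _]mulrC.
- by rewrite ![U q _ * _]mulrC.
Qed.

(** With z_i = x u^* and z_j = y v^*, where x, y are entries of one row and
    u, v the entries below them, the minor depends only on z_i and z_j. *)
Lemma norm_det2_unimodular (x y u v : C) :
  `|x| = 1 -> `|y| = 1 -> `|u| = 1 -> `|v| = 1 ->
  `|x * v - y * u| ^+ 2 =
  2 - (x * u^*) * (y * v^*)^* - (y * v^*) * (x * u^*)^*.
Proof.
have sq1 (t : C) : `|t| = 1 -> t * t^* = 1.
  by rewrite -normCK => ->; rewrite expr1n.
move=> /sq1 x1 /sq1 y1 /sq1 u1 /sq1 v1.
rewrite normCK !(rmorphB, rmorphM) /= !conjCK.
(* Homogenise: the constant collects x v (x v)^* and y u (y u)^*. *)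
have -> : 2 = (x * x^*) * (v * v^*) + (y * y^*) * (u * u^*) :> C.
  by rewrite x1 y1 u1 v1; ring.
ring.
Qed.

(** * One pair of rows *)

Lemma sum_mul_conj n (w : 'I_n -> C) :
  \sum_i \sum_j w i * (w j)^* = `|\sum_i w i| ^+ 2.
Proof.
rewrite normCK rmorph_sum mulr_suml; apply: eq_bigr => i _.
by rewrite mulr_sumr.
Qed.

Lemma sum_mul_conj_swap n (w : 'I_n -> C) :
  \sum_i \sum_j w j * (w i)^* = `|\sum_i w i| ^+ 2.
Proof. by rewrite exchange_big sum_mul_conj. Qed.

Lemma sum_hermitian_combination n (v w : 'I_n -> C) (k b d : C) :
  \sum_i \sum_j (k - b * (v i * (v j)^* + v j * (v i)^*)
                 + d * (w i * (w j)^* + w j * (w i)^*)) =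
  n%:R ^+ 2 * k - 2 * b * `|\sum_i v i| ^+ 2 + 2 * d * `|\sum_i w i| ^+ 2.
Proof.
have lin (P Q : 'I_n -> 'I_n -> C) :
    \sum_i \sum_j (k - b * P i j + d * Q i j) =
    n%:R ^+ 2 * k - b * \sum_i \sum_j P i j + d * \sum_i \sum_j Q i j.
  under eq_bigr do rewrite big_split sumrB /= -!mulr_sumr sumr_const_ord.
  by rewrite big_split sumrB /= -!mulr_sumr sumr_const_ord; ring.
have twice (u : 'I_n -> C) :
    \sum_i \sum_j (u i * (u j)^* + u j * (u i)^*) = 2 * `|\sum_i u i| ^+ 2.
  under eq_bigr do rewrite big_split.
  by rewrite big_split /= sum_mul_conj sum_mul_conj_swap; ring.
by rewrite lin !twice; ring.
Qed.

(** Put t = z w^*; then t^* = t^-1, so (t + t^-1)^2 = t^2 + t^-2 + 2 and the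
    square contains only products that separate z from w. *)
Lemma unimodular_sqr_deviation (z w a c : C) :
  z * z^* = 1 -> w * w^* = 1 ->
  (a * (2 - z * w^* - w * z^*) - c) ^+ 2 =
  (2 * a - c) ^+ 2 + 2 * a ^+ 2
  - 2 * a * (2 * a - c) * (z * w^* + w * z^*)
  + a ^+ 2 * (z ^+ 2 * (w ^+ 2)^* + w ^+ 2 * (z ^+ 2)^*).
Proof.
move=> z1 w1; rewrite !rmorphXn /=.
(* Homogenise the constant coming from the cross term 2 t t^-1. *)
have -> : 2 * a ^+ 2 = 2 * a ^+ 2 * ((z * z^*) * (w * w^*)).
  by rewrite z1 w1 !mulr1.
ring.
Qed.

(** The terms with i = j, where the minor degenerates to 0, each contribute
    c ^+ 2 to the full square and account for the term n c ^+ 2. *)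
Lemma sum_sqr_deviation n (z : 'I_n -> C) (a c : C) :
  (forall i, z i * (z i)^* = 1) -> \sum_i z i = 0 ->
  (\sum_(i < n) \sum_(j < n | (i < j)%N)
     (a * (2 - z i * (z j)^* - z j * (z i)^*) - c) ^+ 2) *+ 2 =
  n%:R ^+ 2 * ((2 * a - c) ^+ 2 + 2 * a ^+ 2) - n%:R * c ^+ 2
  + 2 * a ^+ 2 * `|\sum_i z i ^+ 2| ^+ 2.
Proof.
move=> z1 z0; rewrite sum_ltn_symmetric => [|i j]; last by congr (_ ^+ 2); ring.
have -> : \sum_i (a * (2 - z i * (z i)^* - z i * (z i)^*) - c) ^+ 2 =
    n%:R * c ^+ 2.
  rewrite -sumr_const_ord; apply: eq_bigr => i _.
  by rewrite z1; ring.
under eq_bigr do under eq_bigr do rewrite unimodular_sqr_deviation //.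
by rewrite sum_hermitian_combination z0 normr0; ring.
Qed.

Lemma frobenius_norm_sqr_eq0 m k (A : 'M[C]_(m, k)) :
  frobenius_norm A ^+ 2 = 0 <-> A = 0.
Proof.
split=> [|->]; last first.
  rewrite sqrtCK big1 // => i _; rewrite big1 // => j _.
  by rewrite mxE normr0 expr0n.
rewrite sqrtCK => /psumr_eq0P A0; apply/matrixP=> i j; rewrite mxE.
have /psumr_eq0P Ai0 : \sum_j `|A i j| ^+ 2 = 0.
  by apply: A0 => // k0 _; apply: sumr_ge0 => *; rewrite exprn_ge0.
apply/eqP; rewrite -normr_eq0 -sqrf_eq0; apply/eqP.
by apply: Ai0 => // *; rewrite exprn_ge0.
Qed.

(** * The discrepancy of a normalised Hadamard matrix *)

Section Hadamard.
Variables (n : nat) (H : 'M[C]_n).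
Hypothesis H_hadamard : complex_hadamard H.

Lemma hadamard_rows_orthogonal p q :
  \sum_j H p j * (H q j)^* = n%:R * (p == q)%:R.
Proof.
have [_ /matrixP/(_ p q)] := H_hadamard; rewrite !mxE => <-.
by apply: eq_bigr => j _; rewrite !mxE.
Qed.

Definition sqr_row_product p q := \sum_(j < n) H p j ^+ 2 * ((H q j ^+ 2)^*)%R.

Lemma gram_hadamard_square p q :
  (hadamard_square H *m (hadamard_square H)^t* - n%:R *: 1%:M) p q =
  if p == q then 0 else sqr_row_product p q.
Proof.
have [H1 _] := H_hadamard.
rewrite !mxE; under eq_bigr do rewrite !mxE.
case: eqVneq => [<-|_]; last by rewrite mulr0 subr0.
under eq_bigr do rewrite -normCK normrX H1 !expr1n.
by rewrite sumr_const card_ord mulr1 subrr.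
Qed.

Lemma frobenius_gram_hadamard_square :
  frobenius_norm (hadamard_square H *m (hadamard_square H)^t*
                  - n%:R *: 1%:M) ^+ 2 =
  2 * \sum_(p < n) \sum_(q < n | (p < q)%N) `|sqr_row_product p q| ^+ 2.
Proof.
set G := _ - _.
have Gpp p : G p p = 0 by rewrite gram_hadamard_square eqxx.
have G_sym p q : `|G p q| = `|G q p|.
  rewrite !gram_hadamard_square eq_sym; case: eqP => // _.
  rewrite -norm_conjC rmorph_sum; congr `|_|; apply: eq_bigr => j _.
  by rewrite rmorphM /= conjCK mulrC.
rewrite sqrtCK.
transitivity ((\sum_(p < n) \sum_(q < n | (p < q)%N) `|G p q| ^+ 2) *+ 2).
  rewrite sum_ltn_symmetric => [|p q]; last by rewrite G_sym.
  by rewrite [X in _ - X]big1 ?subr0 // => p _; rewrite Gpp normr0 expr0n.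
rewrite mulr_natl; congr (_ *+ 2).
apply: eq_bigr => p _; apply: eq_bigr => q lt_pq.
by rewrite gram_hadamard_square -val_eqE (ltn_eqF lt_pq).
Qed.

Lemma hadamard_squareP :
  complex_hadamard (hadamard_square H) <->
  hadamard_square H *m (hadamard_square H)^t* - n%:R *: 1%:M = 0.
Proof.
have [H1 _] := H_hadamard; split=> [[_ ->]|/eqP]; first by rewrite subrr.
rewrite subr_eq0 => /eqP; split=> // i j.
by rewrite !mxE normrX H1 expr1n.
Qed.

Lemma delta2_hadamard (U : 'M[C]_n) :
  (1 < n)%N -> H = sqrtC n%:R *: U ->
  delta2 U = (n%:R - 3) / (2 * n%:R)
    + (n%:R ^+ 4)^-1 *
      \sum_(p < n) \sum_(q < n | (p < q)%N) `|sqr_row_product p q| ^+ 2.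
Proof.
move=> n_gt1 HU; have [H1 _] := H_hadamard.
have n0 : n%:R != 0 :> C by rewrite pnatr_eq0; lia.
have n1 : n%:R - 1 != 0 :> C by rewrite subr_eq0 (eqr_nat _ n 1); lia.
have two0 : 2 != 0 :> C by rewrite pnatr_eq0.
have binE : 'C(n, 2)%:R^-1 = 2 / (n%:R * (n%:R - 1)) :> C.
  have b0 : 'C(n, 2)%:R != 0 :> C by rewrite pnatr_eq0 -lt0n bin_gt0.
  by rewrite -natr_bin2 invfM mulrA divff // mul1r.
have rows (p q : 'I_n) : (p < q)%N ->
    \sum_(J : {set 'I_n} | #|J| == 2%N)
      (`|minor2 U [set p; q] J| ^+ 2 - ('C(n, 2)%:R)^-1) ^+ 2 =
    (3 / n%:R ^+ 2 - 2 / (n%:R * (n%:R - 1)))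
    + (n%:R ^+ 4)^-1 * `|sqr_row_product p q| ^+ 2.
  move=> lt_pq; have neq_pq : p != q by rewrite neq_ltn lt_pq.
  pose z i := H p i * (H q i)^*.
  have z1 i : z i * (z i)^* = 1.
    by rewrite -normCK normrM norm_conjC !H1 mulr1 expr1n.
  have z0 : \sum_i z i = 0.
    by rewrite hadamard_rows_orthogonal (negPf neq_pq) mulr0.
  have zz : \sum_i z i ^+ 2 = sqr_row_product p q.
    by apply: eq_bigr => i _; rewrite exprMn rmorphXn.
  rewrite sum_card2_sets; apply: (mulIf two0); rewrite mulr_natr.
  transitivity ((\sum_(i < n) \sum_(j < n | (i < j)%N)
     ((n%:R ^+ 2)^-1 * (2 - z i * (z j)^* - z j * (z i)^*)
      - 'C(n, 2)%:R^-1) ^+ 2) *+ 2).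
    congr (_ *+ 2); apply: eq_bigr => i _; apply: eq_bigr => j lt_ij.
    rewrite norm_minor2 // ?neq_ltn ?lt_ij //; congr ((_ - _) ^+ 2).
    rewrite -norm_det2_unimodular //.
    have -> : H p i * H q j - H p j * H q i =
        n%:R * (U p i * U q j - U p j * U q i).
      by rewrite HU !mxE -[n%:R in RHS]sqrtCK; ring.
    by rewrite normrM normr_nat exprMn mulKf // expf_neq0.
  rewrite sum_sqr_deviation // zz binE; field.
  by rewrite n0 n1.
rewrite /delta2 sum_card2_sets.
under eq_bigr do under eq_bigr do rewrite rows //.
under eq_bigr do
  rewrite big_split -mulr_sumr -[X in \sum_(_ < _ | _) X]mulr1 -mulr_sumr /=.
rewrite big_split -!mulr_sumr /= card_ltn_pairs; congr (_ + _).
by field; rewrite n0 n1.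
Qed.

End Hadamard.
End Minors.

Theorem theorem5p2 (R : realType) (n : nat) (U : 'M[R[i]]_n) :
  (4 <= n)%N ->
  U \is unitarymx ->
  let H := sqrtC n%:R *: U in
  complex_hadamard H ->
  [/\ delta2 U = (n%:R - 3) / (2 * n%:R)
        + (n%:R ^+ 4)^-1 * \sum_(p < n) \sum_(q < n | (p < q)%N)
            `|\sum_(j < n) H p j ^+ 2 * ((H q j ^+ 2)^*)%R| ^+ 2,
      delta2 U = (n%:R - 3) / (2 * n%:R)
        + (2 * n%:R ^+ 4)^-1
          * frobenius_norm (hadamard_square H *m (hadamard_square H) ^t*
                            - n%:R *: 1%:M) ^+ 2,
      (n%:R - 3) / (2 * n%:R) <= delta2 U
    & delta2 U = (n%:R - 3) / (2 * n%:R)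
        <-> complex_hadamard (hadamard_square H)].
Proof.
move=> n_ge4 _ H H_had.
have n_gt1 : (1 < n)%N by lia.
have n4 : (n%:R ^+ 4)^-1 != 0 :> R[i].
  by rewrite invr_eq0 expf_neq0 // pnatr_eq0; lia.
have delta2E := delta2_hadamard H_had n_gt1 (erefl H).
have frobE := frobenius_gram_hadamard_square H_had.
set S := (X in _ + _ * X) in delta2E.
split=> //.
- rewrite delta2E frobE -/S; congr (_ + _).
  by rewrite [in RHS]invfM [2^-1 * _]mulrC -mulrA mulKf // pnatr_eq0.
- rewrite delta2E lerDl mulr_ge0 ?invr_ge0 ?exprn_ge0 ?ler0n //.
  by apply: sumr_ge0 => p _; apply: sumr_ge0 => q _; rewrite exprn_ge0.
apply: iff_trans (iff_sym (hadamard_squareP H_had)).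
apply: iff_trans (frobenius_norm_sqr_eq0 _).
rewrite frobE -/S delta2E; split=> [/eqP|/eqP].
- rewrite -subr_eq0 addrAC subrr add0r mulf_eq0 (negPf n4) /= => /eqP ->.
  by rewrite mulr0.
- rewrite mulf_eq0 pnatr_eq0 /= => /eqP ->.
  by rewrite mulr0 addr0.
Qed.
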